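(* Let $(X,d_X)$ be a metric space and let $F\subset X$ be a bounded set such that either $F$ is totally bounded or $X$ is a locally totally bounded space. If $F$ is Ahlfors-David $s$-regular, then $F$ is equi-homogeneous and $\dim_{\rm LA}F=\dim_{\rm A}F=s$.
   Context: $B_\delta(x)=\{y\in X:d_X(x,y)\le\delta\}$ is the closed ball, and for $A\subset X$, $\mathcal{N}(A,\delta)$ is the minimum number of closed balls of radius $\delta$ with centres in $A$ whose union contains $A$. A set $A\subset X$ is totally bounded if $\mathcal{N}(A,\delta)<\infty$ for all $\delta>0$; $X$ is locally totally bounded if every ball in $X$ is totally bounded. A bounded set $F\subset X$ is Ahlfors-David $s$-regular if there is a constant $C>0$ such that $C^{-1}\delta^s\le\mathcal{H}^s(B_\delta(x)\cap F)\le C\delta^s$ for all $x\in F$ and all $0<\delta<\operatorname{diam}F$, where $\mathcal{H}^s$ is the $s$-dimensional Hausdorff measure. $F$ is equi-homogeneous if for all $\delta_0>0$ there exist $M\ge1$ and $c_1,c_2>0$ such that $\sup_{x\in F}\mathcal{N}(B_\delta(x)\cap F,\rho)\le M\inf_{x\in F}\mathcal{N}(B_{c_1\delta}(x)\cap F,c_2\rho)$ for all $\delta,\rho$ with $0<\rho<\delta\le\delta_0$. The Assouad dimension $\dim_{\rm A}F$ is the infimum of all $t\in[0,\infty)$ such that for all $\delta_0>0$ there is $C>0$ with $\sup_{x\in F}\mathcal{N}(B_\delta(x)\cap F,\rho)\le C(\delta/\rho)^t$ for all $0<\rho<\delta\le\delta_0$. The lower Assouad dimension $\dim_{\rm LA}F$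 is the supremum of all $t\in[0,\infty)$ such that for all $\delta_0>0$ there is $C>0$ with $\inf_{x\in F}\mathcal{N}(B_\delta(x)\cap F,\rho)\ge C(\delta/\rho)^t$ for all $0<\rho<\delta\le\delta_0$.
   Formalization: F is assumed nonempty, and if diam F = 0 then s = 0 is assumed: the empty set and one-point sets are vacuously s-regular for every s, so the claim dim_LA F = dim_A F = s fails for them otherwise. *)

(* Defs.v *)
From HB Require Import structures.
From mathcomp Require Import all_boot all_order all_algebra finmap.
From mathcomp Require Import all_classical all_reals all_analysis.

Set Implicit Arguments.
Unset Strict Implicit.
Unset Printing Implicit Defensive.

Import Order.TTheory GRing.Theory Num.Theory.

Local Open Scope classical_set_scope.
Local Open Scope ring_scope.
Local Open Scope ereal_scope.

Section Defs.
Context {R : realType} {X : metricType R}.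
Implicit Types (A F : set X) (s t delta rho : R).

(* Not the library's [closed_ball], which is the closure of the open ball. *)
Definition cball (x : X) delta : set X := [set y | (mdist x y <= delta)%R].

(* The element 0 only matters for the empty set, whose diameter is thus 0. *)
Definition diam A : \bar R :=
  ereal_sup (0 |` [set (mdist p.1 p.2)%:E | p in A `*` A]).

Definition bounded A : Prop := diam A < +oo.

(* The infimum ranges over a set of naturals, so it is a minimum, and it is
   +oo exactly when no finite cover exists. *)
Definition covering_number A delta : \bar R :=
  ereal_inf [set (#|` C|%:R)%:E | C in [set C : {fset X} |
    [set` C] `<=` A /\ A `<=` \bigcup_(c in [set` C]) cball c delta]].

Definition totally_bounded A : Prop :=
  forall delta, (0 < delta)%R -> covering_number A delta < +oo.

(* The empty set is treated apart because the powers used here satisfy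
   0 `^ 0 = 1: for s = 0 a nonempty set has size 1 and the empty set size 0,
   so that the 0-dimensional Hausdorff measure is the counting measure. *)
Definition hausdorff_gauge s (U : set X) : \bar R :=
  if U == set0 then 0 else diam U `^ s.

Definition hausdorff_content s delta A : \bar R :=
  ereal_inf [set \sum_(i <oo) hausdorff_gauge s (U i) |
    U in [set U : nat -> set X |
      A `<=` \bigcup_i U i /\ forall i, diam (U i) <= delta%:E]].

(* The content is nonincreasing in delta, so that the supremum is the limit
   as delta tends to 0. This is defined on all subsets of X. *)
Definition hausdorff_measure s A : \bar R :=
  ereal_sup [set hausdorff_content s delta A | delta in [set d : R | (0 < d)%R]].

Definition ahlfors_david_regular s F : Prop :=
  exists2 C : R, (0 < C)%R &
    forall (x : X) delta, F x -> (0 < delta)%R -> delta%:E < diam F ->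
      (C^-1 * delta `^ s)%:E <= hausdorff_measure s (cball x delta `&` F) /\
      hausdorff_measure s (cball x delta `&` F) <= (C * delta `^ s)%:E.

Definition sup_cover F delta rho : \bar R :=
  ereal_sup [set covering_number (cball x delta `&` F) rho | x in F].

Definition inf_cover F delta rho : \bar R :=
  ereal_inf [set covering_number (cball x delta `&` F) rho | x in F].

Definition equi_homogeneous F : Prop :=
  forall delta0 : R, (0 < delta0)%R ->
    exists M c1 c2 : R, [/\ (1 <= M)%R, (0 < c1)%R, (0 < c2)%R &
      forall delta rho, (0 < rho)%R -> (rho < delta)%R -> (delta <= delta0)%R ->
        sup_cover F delta rho <= M%:E * inf_cover F (c1 * delta) (c2 * rho)].

Definition assouad_dim F : \bar R :=
  ereal_inf [set t%:E | t in [set t : R | (0 <= t)%R /\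
    forall delta0 : R, (0 < delta0)%R -> exists2 C : R, (0 < C)%R &
      forall delta rho, (0 < rho)%R -> (rho < delta)%R -> (delta <= delta0)%R ->
        sup_cover F delta rho <= (C * (delta / rho) `^ t)%:E]].

Definition lower_assouad_dim F : \bar R :=
  ereal_sup [set t%:E | t in [set t : R | (0 <= t)%R /\
    forall delta0 : R, (0 < delta0)%R -> exists2 C : R, (0 < C)%R &
      forall delta rho, (0 < rho)%R -> (rho < delta)%R -> (delta <= delta0)%R ->
        (C * (delta / rho) `^ t)%:E <= inf_cover F delta rho]].

End Defs.

Definition locally_totally_bounded {R : realType} (X : metricType R) : Prop :=
  forall (x : X) (r : R), (0 < r)%R -> totally_bounded (cball x r).

(* Main.v *)
(* Write N for the covering number of the piece of F in a ball of radius delta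
   by balls of radius rho < delta. Subadditivity of H^s on a cover bounds N below
   by a multiple of (delta/rho)^s. Conversely, the rho/3-balls around a
   rho-separated set are at positive distance from each other, H^s is additive on
   such families, and hence separated sets have at most a multiple of
   (delta/rho)^s points. A separated set that is not a cover can be enlarged, so
   this also bounds N above. Ahlfors-David regularity only speaks of radii below
   diam F; it extends to larger ones because total boundedness gives
   H^s(F) < +oo. These two-sided bounds give equi-homogeneity with c1 = c2 = 1
   and determine both dimensions. *)
Require Import Defs.
From mathcomp Require Import all_boot all_order all_algebra.
From mathcomp Require Import all_classical all_reals all_analysis.
From mathcomp Require Import finmap ring lra.

Set Implicit Arguments.
Unset Strict Implicit.
Unset Printing Implicit Defensive.

Import Order.TTheory GRing.Theory Num.Theory.

Local Open Scope classical_set_scope.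
Local Open Scope ring_scope.

(** * Infima, suprema and series of extended reals *)

Section extended_reals.
Context {R : realType}.
Local Open Scope ereal_scope.
Implicit Types (S T : set (\bar R)) (z : \bar R).

Lemma le_ereal_infD S T z :
    (forall x, S x -> 0 <= x) -> (forall y, T y -> 0 <= y) ->
    (forall x y, S x -> T y -> z <= x + y) ->
  z <= ereal_inf S + ereal_inf T.
Proof.
move=> S0 T0 zST.
have iS0 : 0 <= ereal_inf S by apply/ereal_infP.
have iT0 : 0 <= ereal_inf T by apply/ereal_infP.
have [iSy|iSy] := eqVneq (ereal_inf S) +oo.
  by rewrite iSy addye ?leey// gt_eqF// (lt_le_trans _ iT0).
have [iTy|iTy] := eqVneq (ereal_inf T) +oo.
  by rewrite iTy addey ?leey// gt_eqF// (lt_le_trans _ iS0).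
have iSf : ereal_inf S \is a fin_num by rewrite ge0_fin_numE// ltey.
have iTf : ereal_inf T \is a fin_num by rewrite ge0_fin_numE// ltey.
apply/lee_addgt0Pr => e e0; have e20 : (0 < e / 2)%R by rewrite divr_gt0.
have [x Sx xS] := lb_ereal_inf_adherent e20 iSf.
have [y Ty yT] := lb_ereal_inf_adherent e20 iTf.
rewrite (le_trans (zST _ _ Sx Ty))// (le_trans (leeD (ltW xS) (ltW yT)))//.
by rewrite addeACA -EFinD -splitr.
Qed.

(** An element of one set, being nonnegative, shows that [z] bounds the supremum of the other.
    Unless [z] is [+oo], both suprema are therefore finite and can be approximated within
    [e / 2]. *)
Lemma ge_ereal_supD S T z : S !=set0 -> T !=set0 ->
    (forall x, S x -> 0 <= x) -> (forall y, T y -> 0 <= y) ->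
    (forall x y, S x -> T y -> x + y <= z) ->
  ereal_sup S + ereal_sup T <= z.
Proof.
move=> [x0 Sx0] [y0 Ty0] S0 T0 STz.
have [->|zy] := eqVneq z +oo; first by rewrite leey.
have Sz : ereal_sup S <= z.
  by apply/ereal_supP => x Sx; rewrite (le_trans _ (STz _ _ Sx Ty0))// leeDl ?T0.
have Tz : ereal_sup T <= z.
  by apply/ereal_supP => y Ty; rewrite (le_trans _ (STz _ _ Sx0 Ty))// leeDr ?S0.
have sS0 : 0 <= ereal_sup S by apply: le_ereal_sup_tmp; exists x0; rewrite ?S0.
have sT0 : 0 <= ereal_sup T by apply: le_ereal_sup_tmp; exists y0; rewrite ?T0.
have sSf : ereal_sup S \is a fin_num.
  by rewrite ge0_fin_numE// (le_lt_trans Sz)// ltey.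
have sTf : ereal_sup T \is a fin_num.
  by rewrite ge0_fin_numE// (le_lt_trans Tz)// ltey.
apply/lee_addgt0Pr => e e0; have e20 : (0 < e / 2)%R by rewrite divr_gt0.
have [x Sx xS] := ub_ereal_sup_adherent e20 sSf.
have [y Ty yT] := ub_ereal_sup_adherent e20 sTf.
rewrite -leeBlDr// (le_trans _ (STz _ _ Sx Ty))//.
rewrite (le_trans _ (leeD (ltW xS) (ltW yT)))//.
by rewrite addeACA -oppeD// -EFinD -splitr.
Qed.

Lemma nneseries_interleave_le (u v w : nat -> \bar R) :
    (forall n, 0 <= u n) -> (forall n, 0 <= v n) ->
    (forall n, w n.*2 = u n) -> (forall n, w n.*2.+1 = v n) ->
  \sum_(i <oo) w i <= \sum_(i <oo) u i + \sum_(i <oo) v i.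
Proof.
move=> u0 v0 wu wv.
have w0 n : 0 <= w n.
  by rewrite -(odd_double_half n); case: odd; rewrite ?add1n ?add0n ?wv ?wu.
apply: lime_le; first exact: is_cvg_nneseries.
apply: nearW => n /=.
(* Lengthening the partial sum to [n.*2] terms makes it split evenly into [n] terms of [u] and [n]
   terms of [v]. *)
apply: (@le_trans _ _ (\sum_(0 <= i < n.*2) w i)).
  by rewrite (lee_sum_nneg_natr _ xpredT)// -addnn leq_addr.
have -> : \sum_(0 <= i < n.*2) w i =
    \sum_(0 <= i < n) u i + \sum_(0 <= i < n) v i.
  elim: n => [|n ih]; first by rewrite !big_geq// adde0.
  by rewrite doubleS !big_nat_recr//= ih wu wv addeACA addeA.
by apply: leeD; apply: nneseries_lim_ge.
Qed.

End extended_reals.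

(** * Hausdorff measure: subadditivity, and superadditivity across gaps *)

Section hausdorff_measure_theory.
Context {R : realType} {X : metricType R}.
Local Open Scope ereal_scope.
Implicit Types (A B U V : set X) (s d g : R).

Lemma diam_ge0 A : 0 <= diam A.
Proof. by apply: ereal_sup_ubound; left. Qed.

Lemma le_diam A B : A `<=` B -> diam A <= diam B.
Proof.
move=> AB; apply: ereal_sup_le => _ [->|[p [p1 p2] <-]]; first by left.
by right; exists p => //; split; apply: AB.
Qed.

Lemma mdist_le_diam A x y : A x -> A y -> (mdist x y)%:E <= diam A.
Proof. by move=> Ax Ay; apply: ereal_sup_ubound; right; exists (x, y). Qed.

Lemma hausdorff_gauge_ge0 s A : 0 <= hausdorff_gauge s A.
Proof. by rewrite /hausdorff_gauge; case: ifP => // _; apply: poweR_ge0. Qed.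

Lemma hausdorff_gauge0 s : hausdorff_gauge s (@set0 X) = 0.
Proof. by rewrite /hausdorff_gauge eqxx. Qed.

Lemma le_hausdorff_gauge s A B : (0 <= s)%R -> A `<=` B ->
  hausdorff_gauge s A <= hausdorff_gauge s B.
Proof.
move=> s0 AB; have [->|A0] := eqVneq A set0.
  by rewrite hausdorff_gauge0 hausdorff_gauge_ge0.
have B0 : B != set0.
  by apply: contraNneq A0 => B0; apply/eqP; rewrite -subset0 -B0.
rewrite /hausdorff_gauge (negbTE A0) (negbTE B0) gt0_ler_poweR//.
- by rewrite in_itv/= diam_ge0 leey.
- by rewrite in_itv/= diam_ge0 leey.
- exact: le_diam.
Qed.

Lemma hausdorff_content_ge0 s d A : 0 <= hausdorff_content s d A.
Proof.
apply/ereal_infP => _ [U _ <-].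
by apply: nneseries_ge0 => n _ _; apply: hausdorff_gauge_ge0.
Qed.

Lemma le_hausdorff_content s d d' A B : (d' <= d)%R -> A `<=` B ->
  hausdorff_content s d A <= hausdorff_content s d' B.
Proof.
move=> dd' AB; apply: ereal_inf_le_tmp => _ [U [BU Ud] <-].
exists U => //; split=> [|i]; first exact: subset_trans BU.
by rewrite (le_trans (Ud i))// lee_fin.
Qed.

Lemma hausdorff_measure_ge0 s A : 0 <= hausdorff_measure s A.
Proof.
apply: le_ereal_sup_tmp; exists (hausdorff_content s 1 A).
  by exists 1%R => /=.
exact: hausdorff_content_ge0.
Qed.

Lemma hausdorff_content_le_measure s d A : (0 < d)%R ->
  hausdorff_content s d A <= hausdorff_measure s A.
Proof. by move=> d0; apply: ereal_sup_ubound; exists d. Qed.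

Lemma le_hausdorff_measure s A B : A `<=` B ->
  hausdorff_measure s A <= hausdorff_measure s B.
Proof.
move=> AB; apply/ereal_supP => _ [d d0 <-].
apply: le_trans (hausdorff_content_le_measure _ _ d0).
exact: le_hausdorff_content.
Qed.

Lemma hausdorff_content0 s d : (0 <= d)%R -> hausdorff_content s d (@set0 X) = 0.
Proof.
move=> d0; apply/eqP; rewrite eq_le hausdorff_content_ge0 andbT.
apply: ge_ereal_inf; exists (\sum_(i <oo) hausdorff_gauge s (@set0 X)).
  exists (fun=> set0) => //; split=> // _.
  apply/ereal_supP => _ [->|[p [//] ]].
  by rewrite lee_fin.
by rewrite eseries0// => n _ _; rewrite hausdorff_gauge0.
Qed.

Lemma hausdorff_measure0 s : hausdorff_measure s (@set0 X) = 0.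
Proof.
apply/eqP; rewrite eq_le hausdorff_measure_ge0 andbT.
by apply/ereal_supP => _ [d /= d0 <-]; rewrite hausdorff_content0// ltW.
Qed.

Lemma hausdorff_content_setU s d A B :
  hausdorff_content s d (A `|` B) <=
  hausdorff_content s d A + hausdorff_content s d B.
Proof.
apply: le_ereal_infD => [_ [U _ <-]|_ [U _ <-]|_ _ [U [AU Ud] <-] [V [BV Vd] <-]].
- by apply: nneseries_ge0 => n _ _; apply: hausdorff_gauge_ge0.
- by apply: nneseries_ge0 => n _ _; apply: hausdorff_gauge_ge0.
(* Covers are sequences, so the two are interleaved: [U] at even indices, [V] at odd ones. *)
pose W n := if odd n then V n./2 else U n./2.
have WU n : W n.*2 = U n by rewrite /W odd_double doubleK.
have WV n : W n.*2.+1 = V n by rewrite /W /= odd_double /= uphalf_double.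
apply: ge_ereal_inf; exists (\sum_(i <oo) hausdorff_gauge s (W i)); last first.
  apply: nneseries_interleave_le => n; rewrite ?WU ?WV//;
  exact: hausdorff_gauge_ge0.
exists W => //; split; last by move=> i; rewrite /W; case: ifP.
move=> x [/AU[n _ Un]|/BV[n _ Vn]].
  by exists n.*2 => //; rewrite WU.
by exists n.*2.+1 => //; rewrite WV.
Qed.

Lemma hausdorff_measure_setU s A B :
  hausdorff_measure s (A `|` B) <= hausdorff_measure s A + hausdorff_measure s B.
Proof.
apply/ereal_supP => _ [d d0 <-].
apply: le_trans (hausdorff_content_setU _ _ _ _) _.
by apply: leeD; apply: hausdorff_content_le_measure.
Qed.

Lemma hausdorff_measure_bigsetU s (I : Type) (l : seq I) (D : I -> set X) :
  hausdorff_measure s (\big[setU/set0]_(i <- l) D i) <=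
  \sum_(i <- l) hausdorff_measure s (D i).
Proof.
elim: l => [|i l ih]; first by rewrite !big_nil hausdorff_measure0.
rewrite !big_cons; apply: le_trans (hausdorff_measure_setU _ _ _) _.
exact: leeD.
Qed.

(* A set of diameter at most the gap [g] meets only one of [A] and [B], so that
   a fine cover of the union splits into covers of [A] and of [B]. *)
Lemma hausdorff_content_setU_gap s d g A B : (0 <= s)%R -> (d <= g)%R ->
    (forall a b, A a -> B b -> (g < mdist a b)%R) ->
  hausdorff_content s d A + hausdorff_content s d B <=
  hausdorff_content s d (A `|` B).
Proof.
move=> s0 dg ABg; apply/ereal_infP => _ [W [ABW Wd] <-].
have gaugeI i : hausdorff_gauge s (W i `&` A) + hausdorff_gauge s (W i `&` B) <=
    hausdorff_gauge s (W i).
  have [->|/set0P[a [Wa Aa]]] := eqVneq (W i `&` A) set0.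
    by rewrite hausdorff_gauge0 add0e le_hausdorff_gauge.
  have [->|/set0P[b [Wb Bb]]] := eqVneq (W i `&` B) set0.
    by rewrite hausdorff_gauge0 adde0 le_hausdorff_gauge.
  have := le_trans (mdist_le_diam Wa Wb) (Wd i); rewrite lee_fin => abd.
  by have := lt_le_trans (ABg _ _ Aa Bb) (le_trans abd dg); rewrite ltxx.
apply: (@le_trans _ _ (\sum_(i <oo)
    (hausdorff_gauge s (W i `&` A) + hausdorff_gauge s (W i `&` B)))).
  rewrite nneseriesD; [|by move=> *; exact: hausdorff_gauge_ge0..].
  apply: leeD; apply: ereal_inf_lbound.
    exists (fun i => W i `&` A) => //; split=> [x Ax|i].
      by have [|i _ Wx] := ABW x; [left|exists i].
    by rewrite (le_trans _ (Wd i))// le_diam.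
  exists (fun i => W i `&` B) => //; split=> [x Bx|i].
    by have [|i _ Wx] := ABW x; [right|exists i].
  by rewrite (le_trans _ (Wd i))// le_diam.
apply: lee_nneseries => [i _ _|i _]; last exact: gaugeI.
by rewrite adde_ge0// hausdorff_gauge_ge0.
Qed.

Lemma hausdorff_measure_setU_gap s g A B : (0 <= s)%R -> (0 < g)%R ->
    (forall a b, A a -> B b -> (g < mdist a b)%R) ->
  hausdorff_measure s A + hausdorff_measure s B <= hausdorff_measure s (A `|` B).
Proof.
move=> s0 g0 ABg; apply: ge_ereal_supD.
- by exists (hausdorff_content s 1 A), 1%R => //=.
- by exists (hausdorff_content s 1 B), 1%R => //=.
- by move=> _ [d _ <-]; exact: hausdorff_content_ge0.
- by move=> _ [d _ <-]; exact: hausdorff_content_ge0.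
move=> _ _ [d1 /= d10 <-] [d2 /= d20 <-].
(* Contents only grow when the scale shrinks, so [d1] and [d2] may be replaced by a common scale,
   which is also taken below the gap. *)
pose d := Num.min g (Num.min d1 d2).
have d0 : (0 < d)%R by rewrite !lt_min g0 d10.
apply: le_trans (hausdorff_content_le_measure _ _ d0).
apply: le_trans (hausdorff_content_setU_gap s0 _ ABg); last first.
  by rewrite ge_min lexx.
by apply: leeD; apply: le_hausdorff_content; rewrite // /d !ge_min lexx !orbT.
Qed.

Lemma hausdorff_measure_bigsetU_gap s g (I : Type) (l : seq I)
    (r : rel I) (D : I -> set X) : (0 <= s)%R -> (0 < g)%R ->
    (forall i j, r i j -> forall a b, D i a -> D j b -> (g < mdist a b)%R) ->
    pairwise r l ->
  \sum_(i <- l) hausdorff_measure s (D i) <=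
  hausdorff_measure s (\big[setU/set0]_(i <- l) D i).
Proof.
move=> s0 g0 rD; elim: l => [|i l ih].
  by rewrite !big_nil hausdorff_measure_ge0.
rewrite pairwise_cons => /andP[ril rl]; rewrite !big_cons.
apply: le_trans (hausdorff_measure_setU_gap s0 g0 _).
  by rewrite leeD2l// ih.
(* The head is related to every later index, so a second induction keeps [D i] at distance more than
   [g] from the whole union of the tail. *)
move=> a b Da; elim: l ril {ih rl} => [_|j l ih /= /andP[rij ril]].
  by rewrite big_nil.
by rewrite big_cons => -[Db|]; [exact: rD rij _ _ Da Db|exact: ih].
Qed.

End hausdorff_measure_theory.

(** * Covering numbers, separated lists and Hausdorff measure *)

Section covering_number_theory.
Context {R : realType} {X : metricType R}.
Local Open Scope ereal_scope.
Implicit Types (A B F : set X) (s d delta rho b h : R) (l : seq X).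

Lemma sume_const_seq (I : Type) (l : seq I) b :
  \sum_(i <- l) b%:E = ((size l)%:R * b)%:E.
Proof.
elim: l => [|i l ih]; first by rewrite big_nil mul0r.
by rewrite big_cons ih -EFinD /= mulrS mulrDl mul1r.
Qed.

Lemma covering_number_le_size A delta l : (forall c, c \in l -> A c) ->
    A `<=` \bigcup_(c in [set` l]) cball c delta ->
  covering_number A delta <= (size l)%:R%:E.
Proof.
move=> lA Al; apply: ge_ereal_inf.
exists (#|` [fset c in l]%fset|%:R)%:E; last first.
  by rewrite lee_fin ler_nat card_fseq size_undup.
exists [fset c in l]%fset => //; split=> [c|x /Al[c /= cl xc]].
  by rewrite /= inE; exact: lA.
by exists c; rewrite //= inE.
Qed.

Lemma covering_number_ge1 A delta : A !=set0 -> 1 <= covering_number A delta.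
Proof.
move=> [x Ax]; apply/ereal_infP => _ [C [_ AC] <-].
have [c /= cC _] := AC _ Ax.
by rewrite lee_fin ler1n cardfs_gt0; apply/fset0Pn; exists c.
Qed.

(** Greedy argument: if the covering number exceeded [M], no separated list could cover, since its
    size is at most [M]. Every separated list could then be extended, eventually beyond [M]
    entries. *)
Lemma covering_number_le_separated A rho (M : R) :
    (forall l, (forall c, c \in l -> A c) ->
      pairwise (fun x y => rho < mdist x y)%R l -> ((size l)%:R <= M)%R) ->
  covering_number A rho <= M%:E.
Proof.
move=> AM; rewrite leNgt; apply/negP => MN.
have extend n : exists l, [/\ size l = n, forall c, c \in l -> A c &
    pairwise (fun x y => rho < mdist x y)%R l].
  elim: n => [|n [l [ln lA lsep]]]; first by exists [::].
  have [x [Ax xl]] : exists x, A x /\ forall c, c \in l -> (rho < mdist x c)%R.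
    (* If nothing can be added, every point of [A] is within [rho] of an entry, so the list is a
       cover. *)
    apply: contrapT => noext.
    have /(lt_le_trans MN) : covering_number A rho <= (size l)%:R%:E.
      apply: covering_number_le_size => // x Ax.
      apply: contrapT => xl; apply: noext; exists x; split=> // c cl.
      rewrite ltNge; apply/negP => xc; apply: xl.
      by exists c; rewrite //= /cball /= metric_sym.
    by rewrite lte_fin ltNge AM.
  exists (x :: l); split=> /=; first by rewrite ln.
    by move=> c; rewrite inE => /orP[/eqP->//|]; exact: lA.
  by rewrite lsep andbT; apply/allP => c; exact: xl.
have M0 : (0 <= M)%R by have := AM [::]; apply.
have [l [ln lA lsep]] := extend (Num.truncn M).+1.
by have := AM _ lA lsep; rewrite ln leNgt truncnS_gt.
Qed.

(** Serves twice: for the lower bound on covering numbers and for the finiteness of the measure of a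
    regular totally bounded set. *)
Lemma hausdorff_measure_le_cover s rho b A l :
    A `<=` \bigcup_(c in [set` l]) cball c rho ->
    (forall c, c \in l -> hausdorff_measure s (cball c rho `&` A) <= b%:E) ->
  hausdorff_measure s A <= ((size l)%:R * b)%:E.
Proof.
move=> Al lb.
have /(le_hausdorff_measure s)/le_trans : A `<=` \big[setU/set0]_(c <- l) (cball c rho `&` A).
  rewrite -bigcup_seq => x Ax; have [c cl xc] := Al _ Ax.
  by exists c.
apply; apply: le_trans (hausdorff_measure_bigsetU _ _ _) _.
rewrite -sume_const_seq big_seq [leRHS]big_seq.
exact: lee_sum.
Qed.

Lemma covering_number_ge_hausdorff s rho b h A : (0 < b)%R ->
    (forall c, A c -> hausdorff_measure s (cball c rho `&` A) <= b%:E) ->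
    h%:E <= hausdorff_measure s A ->
  (h / b)%:E <= covering_number A rho.
Proof.
move=> b0 Ab hA; apply/ereal_infP => _ [C [CA AC] <-].
rewrite lee_fin ler_pdivrMr// -lee_fin (le_trans hA)//.
by apply: hausdorff_measure_le_cover AC _ => c cC; apply/Ab/CA.
Qed.

(** Packing argument: the [rho / 3]-balls around a [rho]-separated list each carry mass at least
    [b], and their masses add up to at most [h]. The set [B] may be larger than [A], leaving room
    for balls centred near the edge of [A]. *)
Lemma covering_number_le_hausdorff s rho b h A B : (0 <= s)%R -> (0 < rho)%R ->
    (0 < b)%R ->
    (forall c, A c -> b%:E <= hausdorff_measure s (cball c (rho / 3) `&` B)) ->
    hausdorff_measure s B <= h%:E ->
  covering_number A rho <= (h / b)%:E.
Proof.
move=> s0 rho0 b0 Ab Bh; apply: covering_number_le_separated => l lA lsep.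
rewrite ler_pdivlMr// -lee_fin -sume_const_seq.
apply: (@le_trans _ _ (\sum_(c <- l) hausdorff_measure s (cball c (rho / 3) `&` B))).
  by rewrite big_seq [leRHS]big_seq; apply: lee_sum => c /lA; exact: Ab.
(* Centres more than [rho] apart leave more than [rho / 3] between the balls, so [rho / 4] is a
   valid gap. *)
have rho40 : (0 < rho / 4)%R by rewrite divr_gt0.
apply: le_trans (hausdorff_measure_bigsetU_gap s0 rho40 _ lsep) _.
  move=> x y xy a c [/= xa _] [/= yc _]; rewrite /cball /= in xa yc.
  have := metric_triangle x a y; have := metric_triangle a c y.
  rewrite (metric_sym c y); lra.
apply: le_trans Bh; apply: le_hausdorff_measure.
by elim/big_ind : _ => [//|U V UB VB x [/UB|/VB]//|c _ x []].
Qed.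

Lemma totally_bounded_subset A B : A `<=` B -> totally_bounded B ->
  totally_bounded A.
Proof.
move=> AB Btb delta delta0.
have d20 : (0 < delta / 2)%R by rewrite divr_gt0.
have [_ [C [_ BC] _] _] := ereal_inf_lt (Btb _ d20).
(* Centres must lie in [A]. Each half-radius ball that meets [A] gets one of its points in [A] as
   new centre, which at most doubles the radius; the other balls are dropped. *)
pose P c := A `&` cball c (delta / 2).
pose l := [seq xget c (P c) | c <- C & `[< P c !=set0 >]].
apply: (@le_lt_trans _ _ (size l)%:R%:E); last exact: ltry.
apply: covering_number_le_size => [_ /mapP[c + ->]|x Ax].
  by rewrite mem_filter => /andP[/asboolP/(xgetPex c)[]].
have [c /= cC xc] := BC _ (AB _ Ax).
have Pc : P c !=set0 by exists x.
exists (xget c (P c)).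
  by apply/mapP; exists c; rewrite // mem_filter cC andbT; apply/asboolP.
have [_] := xgetPex c Pc; rewrite /cball /= => cy.
rewrite [leRHS]splitr metric_sym (le_trans (metric_triangle x c _))// lerD//.
by rewrite metric_sym.
Qed.

End covering_number_theory.

(** * Two-sided covering bounds for Ahlfors-David regular sets *)

Section ahlfors_david.
Context {R : realType} {X : metricType R}.
Implicit Types (F : set X) (s t delta rho : R).

Lemma powR_divM (x y s : R) : 0 <= x -> 0 < y ->
  x `^ s = (x / y) `^ s * y `^ s.
Proof.
by move=> x0 y0; rewrite -powRM ?divr_ge0 ?(ltW y0)// divfK// gt_eqF.
Qed.

Lemma ahlfors_david_hausdorff_le F s : totally_bounded F -> 0 <= s ->
    (0 < diam F)%E -> bounded F -> ahlfors_david_regular s F ->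
  exists2 K, 0 < K & forall x delta, F x -> 0 < delta ->
    (hausdorff_measure s (cball x delta `&` F) <= (K * delta `^ s)%:E)%E.
Proof.
move=> Ftb s0 F0 Fb [K K0 FK].
have [D DF] : exists D, diam F = D%:E.
  by exists (fine (diam F)); rewrite fineK// ge0_fin_numE// ltW.
have D0 : 0 < D by move: F0; rewrite DF lte_fin.
(* [D / 2] is a radius at which regularity applies; finitely many such balls cover [F] and bound its
   total measure. *)
have D20 : 0 < D / 2 by rewrite divr_gt0.
have D2D : ((D / 2)%:E < diam F)%E by rewrite DF lte_fin; lra.
have [_ [C [CF FC] _] _] := ereal_inf_lt (Ftb _ D20).
pose N : R := #|` C|%:R.
have N0 : 0 <= N by [].
have HF : (hausdorff_measure s F <= (N * (K * (D / 2) `^ s))%:E)%E.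
  apply: hausdorff_measure_le_cover FC _ => c cC.
  by have [] := FK c (D / 2) (CF _ cC) D20 D2D.
(* The summand 1 handles [delta < D]. The summand [N] handles [D <= delta], where the measure of all
   of [F] is compared with the power of [delta] through [D / 2 <= delta]. *)
exists ((1 + N) * K); first by rewrite mulr_gt0// ltr_wpDr.
move=> x delta Fx delta0; have [deltaD|Ddelta] := ltP delta D.
  have [|_ /le_trans] := FK x delta Fx delta0; first by rewrite DF lte_fin.
  apply; rewrite lee_fin ler_wpM2r ?powR_ge0//.
  by rewrite ler_peMl ?(ltW K0)// lerDl.
apply: le_trans (le_hausdorff_measure _ (@subIsetr _ _ _)) _.
apply: le_trans HF _; rewrite lee_fin mulrA ler_pM ?mulr_ge0 ?powR_ge0 ?(ltW K0)//.
  by rewrite ler_wpM2r ?(ltW K0)// lerDr.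
by rewrite ge0_ler_powR ?nnegrE ?(ltW delta0) ?(ltW D20)//; lra.
Qed.

Lemma ahlfors_david_hausdorff_ge F s (delta0 : R) : 0 <= s -> 0 < delta0 ->
    (0 < diam F)%E -> bounded F -> ahlfors_david_regular s F ->
  exists2 k, 0 < k & forall x delta, F x -> 0 < delta -> delta <= delta0 ->
    ((k * delta `^ s)%:E <= hausdorff_measure s (cball x delta `&` F))%E.
Proof.
move=> s0 delta00 F0 Fb [K K0 FK].
have [D DF] : exists D, diam F = D%:E.
  by exists (fine (diam F)); rewrite fineK// ge0_fin_numE// ltW.
have D0 : 0 < D by move: F0; rewrite DF lte_fin.
(* Shrinking the radii by [e] brings all of them below the diameter. *)
pose e := Num.min 1 (D / (2 * delta0)).
have e0 : 0 < e by rewrite lt_min ltr01 divr_gt0// mulr_gt0.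
exists (K^-1 * e `^ s); first by rewrite mulr_gt0 ?invr_gt0// powR_gt0.
move=> x delta Fx d0 dd0.
have ed0 : 0 < e * delta by rewrite mulr_gt0.
have edD : ((e * delta)%:E < diam F)%E.
  rewrite DF lte_fin (@le_lt_trans _ _ (D / 2))//; last by lra.
  rewrite (@le_trans _ _ (D / (2 * delta0) * delta0))//.
    by rewrite ler_pM ?(ltW e0) ?(ltW d0)// ge_min lexx orbT.
  by rewrite invfM mulrA divfK ?gt_eqF.
have [+ _] := FK x (e * delta) Fx ed0 edD.
rewrite powRM ?(ltW e0) ?(ltW d0)// mulrA => /le_trans; apply.
apply: le_hausdorff_measure => y [xy Fy]; split=> //.
by rewrite /cball /= (le_trans xy)// ler_piMl ?(ltW d0)// ge_min lexx.
Qed.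

Lemma ahlfors_david_covering_number F s (delta0 : R) : F !=set0 ->
    bounded F -> totally_bounded F -> 0 <= s -> (diam F = 0%E -> s = 0) ->
    ahlfors_david_regular s F -> 0 < delta0 ->
  exists a b : R, [/\ 0 < a, 0 < b & forall x delta rho, F x ->
    0 < rho -> rho < delta -> delta <= delta0 ->
    ((a * (delta / rho) `^ s)%:E <= covering_number (cball x delta `&` F) rho)%E /\
    (covering_number (cball x delta `&` F) rho <= (b * (delta / rho) `^ s)%:E)%E].
Proof.
move=> F0 Fb Ftb s0 Fs Freg delta00.
(* At diameter 0 regularity is vacuous. Here [F] is a single point, [s] is 0 and every covering
   number is 1. *)
have [dF0|dF0] := eqVneq (diam F) 0%E.
  exists 1, 1; split=> // x delta rho Fx rho0 rhodelta _.
  have xdelta : (cball x delta `&` F) x.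
    by split=> //; rewrite /cball /= mdistxx ltW// (lt_trans rho0).
  rewrite Fs// powRr0 mulr1; split; first by apply: covering_number_ge1; exists x.
  have -> : 1%:E = (size [:: x])%:R%:E :> \bar R by [].
  apply: covering_number_le_size => [c|y [_ Fy]].
    by rewrite inE => /eqP ->.
  exists x; first by rewrite /= inE.
  have := mdist_le_diam Fx Fy; rewrite dF0 lee_fin /cball /= => /le_trans; apply.
  exact: ltW.
have {}dF0 : (0 < diam F)%E by rewrite lt_def dF0 diam_ge0.
have [K K0 FK] := ahlfors_david_hausdorff_le Ftb s0 dF0 Fb Freg.
have [k k0 Fk] := ahlfors_david_hausdorff_ge s0 delta00 dF0 Fb Freg.
(* The first constant compares mass at least k delta^s with balls of mass at most K rho^s. The
   second compares mass at most K (2 delta)^s with balls of mass at least k (rho/3)^s, and 6 is 2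
   divided by 1/3. *)
exists (k / K), (K / k * 6 `^ s); split.
- by rewrite divr_gt0.
- by rewrite mulr_gt0 ?divr_gt0// powR_gt0.
move=> x delta rho Fx rho0 rhodelta deltadelta0.
have d0 : 0 < delta by exact: lt_trans rhodelta.
have rs0 : 0 < rho `^ s by rewrite powR_gt0.
split.
  have -> : k / K * (delta / rho) `^ s = k * delta `^ s / (K * rho `^ s).
    by rewrite (powR_divM s (ltW d0) rho0); field; rewrite !gt_eqF.
  apply: (covering_number_ge_hausdorff (s := s)) => [|c [_ Fc]|].
  - by rewrite mulr_gt0.
  - apply: le_trans (FK c rho Fc rho0); apply: le_hausdorff_measure.
    by move=> y [cy [_ Fy]].
  - exact: Fk.
have r30 : 0 < rho / 3 by rewrite divr_gt0.
have -> : K / k * 6 `^ s * (delta / rho) `^ s =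
    K * (2 * delta) `^ s / (k * (rho / 3) `^ s).
  have d20 : 0 <= 2 * delta by rewrite mulr_ge0// ltW.
  rewrite (powR_divM s d20 r30).
  have -> : 2 * delta / (rho / 3) = 6 * (delta / rho).
    by field; rewrite gt_eqF.
  rewrite (@powRM _ 6) ?divr_ge0 ?(ltW d0) ?(ltW rho0)//; field.
  by rewrite !gt_eqF// powR_gt0.
(* Since [rho / 3 < delta], the small balls around points of the [delta]-ball stay inside the ball
   of radius [2 * delta]. *)
apply: (covering_number_le_hausdorff (B := cball x (2 * delta) `&` F) s0 rho0).
- by rewrite mulr_gt0// powR_gt0.
- move=> c [xc Fc]; apply: le_trans (Fk c (rho / 3) Fc r30 _) _; first by lra.
  apply: le_hausdorff_measure => y [cy Fy]; split=> //; split=> //.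
  move: xc cy; rewrite /cball /= => xc cy.
  by have := metric_triangle x c y; lra.
- by apply: FK; rewrite // mulr_gt0.
Qed.

End ahlfors_david.

(** * Consequences of power-law covering numbers *)

Lemma powR_lt_powR_large (R : realType) (s t a c : R) : t < s -> 0 < a -> 0 < c ->
  exists2 q, 1 < q & c * q `^ t < a * q `^ s.
Proof.
move=> ts a0 c0; have st0 : 0 < s - t by rewrite subr_gt0.
have y1 : 1 < 1 + c / a by rewrite ltrDl divr_gt0.
(* Chosen so that q^(s - t) = 1 + c/a, whence a q^(s - t) = a + c exceeds c. *)
exists ((1 + c / a) `^ (s - t)^-1).
  have : 1 `^ (s - t)^-1 < (1 + c / a) `^ (s - t)^-1.
    by rewrite gt0_ltr_powR ?invr_gt0 ?nnegrE ?(le_trans ler01 (ltW y1)).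
  by rewrite powR1.
set q := (1 + c / a) `^ (s - t)^-1; have q0 : 0 < q by exact/powR_gt0/(lt_trans ltr01 y1).
have -> : q `^ s = q `^ (s - t) * q `^ t.
  by rewrite -powRD ?subrK//; apply/implyP => _; rewrite gt_eqF.
rewrite mulrA ltr_pM2r ?(powR_gt0 _ q0)// /q -powRrM mulVf ?gt_eqF// powRr1.
  by rewrite mulrDr mulr1 mulrCA divff ?gt_eqF// mulr1 ltrDr.
by rewrite (le_trans ler01)// ltW.
Qed.

Section power_law.
Context {R : realType} {X : metricType R}.
Variables (F : set X) (s : R).
Hypotheses (F0 : F !=set0) (s0 : 0 <= s).
Hypothesis FN : forall delta0 : R, 0 < delta0 ->
  exists a b : R, [/\ 0 < a, 0 < b & forall x delta rho, F x ->
    0 < rho -> rho < delta -> delta <= delta0 ->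
    ((a * (delta / rho) `^ s)%:E <= covering_number (cball x delta `&` F) rho)%E /\
    (covering_number (cball x delta `&` F) rho <= (b * (delta / rho) `^ s)%:E)%E].

(** The middle inequality, from a point of [F], confronts a bound assumed on the supremum with the
    power law below the infimum, and conversely. *)
Let cover_bounds (delta0 : R) : 0 < delta0 ->
  exists a b : R, [/\ 0 < a, 0 < b & forall delta rho,
    0 < rho -> rho < delta -> delta <= delta0 ->
    [/\ ((a * (delta / rho) `^ s)%:E <= inf_cover F delta rho)%E,
      (inf_cover F delta rho <= sup_cover F delta rho)%E &
      (sup_cover F delta rho <= (b * (delta / rho) `^ s)%:E)%E]].
Proof.
move=> /FN[a [b [a0 b0 ab]]]; exists a, b; split=> // delta rho r0 rd dd; split.
- by apply/ereal_infP => _ [x Fx <-]; have [] := ab x delta rho Fx r0 rd dd.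
- have [x Fx] := F0.
  apply: (@le_trans _ _ (covering_number (cball x delta `&` F) rho)).
    by apply: ereal_inf_lbound; exists x.
  by apply: ereal_sup_ubound; exists x.
- by apply/ereal_supP => _ [x Fx <-]; have [] := ab x delta rho Fx r0 rd dd.
Qed.

Lemma power_law_equi_homogeneous : equi_homogeneous F.
Proof.
move=> delta0 /cover_bounds[a [b [a0 b0 ab]]].
(* [b / a] is the ratio of the two power-law constants; the maximum with 1 meets the requirement
   [1 <= M]. *)
exists (Num.max 1 (b / a)), 1, 1; split=> //; first by rewrite le_max lexx.
move=> delta rho r0 rd dd; rewrite !mul1r.
have [lo _ up] := ab delta rho r0 rd dd.
have M0 : 0 < Num.max 1 (b / a) by rewrite lt_max ltr01.
rewrite (le_trans up)// (le_trans _ (lee_wpmul2l _ lo)) ?lee_fin ?(ltW M0)//.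
rewrite mulrA ler_wpM2r ?powR_ge0// -ler_pdivrMr//.
by rewrite le_max lexx orbT.
Qed.

(** The exponent [s] is itself admissible. A smaller [t] would give a q^s <= C q^t for all q > 1, by
    taking radii 1 and 1/q, which fails for a suitable q. *)
Lemma power_law_assouad_dim : assouad_dim F = s%:E.
Proof.
apply/eqP; rewrite eq_le; apply/andP; split.
  apply: ereal_inf_lbound; exists s => //; split=> // delta0.
  move=> /cover_bounds[a [b [a0 b0 ab]]]; exists b => // delta rho r0 rd dd.
  by have [] := ab delta rho r0 rd dd.
apply/ereal_infP => _ [t [t0 Ft] <-]; rewrite lee_fin leNgt; apply/negP => ts.
have [a [b [a0 b0 ab]]] := cover_bounds ltr01.
have [C C0 FC] := Ft _ ltr01.
have [q q1 Cq] := powR_lt_powR_large ts a0 C0.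
have q0 : 0 < q by rewrite (lt_trans ltr01).
have qV0 : 0 < q^-1 by rewrite invr_gt0.
have qV1 : q^-1 < 1 by rewrite invf_lt1.
have [+ ls _] := ab 1 q^-1 qV0 qV1 (lexx _).
move=> /le_trans/(_ ls)/le_trans/(_ (FC 1 q^-1 qV0 qV1 (lexx _))).
by rewrite lee_fin div1r invrK leNgt Cq.
Qed.

(** Dual argument: an admissible [t] above [s] would give C q^t <= b q^s for all q > 1. *)
Lemma power_law_lower_assouad_dim : lower_assouad_dim F = s%:E.
Proof.
apply/eqP; rewrite eq_le; apply/andP; split; last first.
  apply: ereal_sup_ubound; exists s => //; split=> // delta0.
  move=> /cover_bounds[a [b [a0 b0 ab]]]; exists a => // delta rho r0 rd dd.
  by have [] := ab delta rho r0 rd dd.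
apply/ereal_supP => _ [t [t0 Ft] <-]; rewrite lee_fin leNgt; apply/negP => st.
have [a [b [a0 b0 ab]]] := cover_bounds ltr01.
have [C C0 FC] := Ft _ ltr01.
have [q q1 bq] := powR_lt_powR_large st C0 b0.
have q0 : 0 < q by rewrite (lt_trans ltr01).
have qV0 : 0 < q^-1 by rewrite invr_gt0.
have qV1 : q^-1 < 1 by rewrite invf_lt1.
have [_ ls up] := ab 1 q^-1 qV0 qV1 (lexx _).
have := le_trans (FC 1 q^-1 qV0 qV1 (lexx _)) (le_trans ls up).
by rewrite lee_fin div1r invrK leNgt bq.
Qed.

End power_law.

(* [hF0] and [hFs] exclude only the empty set, and the one-point sets with
   s <> 0: these are s-regular vacuously for every s, and the conclusion fails
   for them. *)
Theorem theorem3p8 (R : realType) (X : metricType R) (F : set X) (s : R)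
    (hF0 : F !=set0) (hFb : bounded F)
    (htb : totally_bounded F \/ locally_totally_bounded X)
    (hs : 0 <= s) (hFs : diam F = 0%E -> s = 0)
    (hreg : ahlfors_david_regular s F) :
  equi_homogeneous F /\ lower_assouad_dim F = s%:E /\ assouad_dim F = s%:E.
Proof.
have Ftb : totally_bounded F.
  case: htb => // Xtb; have [x Fx] := hF0.
  (* [F] lies in the ball of radius its diameter around any of its points; adding 1 keeps the radius
     positive for a one-point set. *)
  apply: totally_bounded_subset (Xtb x (fine (diam F) + 1) _).
    move=> y Fy; rewrite /cball /=.
    have := mdist_le_diam Fx Fy; rewrite -[diam F]fineK ?lee_fin.
      by move=> /le_trans; apply; rewrite lerDl.
    by rewrite ge0_fin_numE// diam_ge0.
  by rewrite ltr_wpDl// fine_ge0// diam_ge0.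
have FN delta0 (delta00 : 0 < delta0) :=
  ahlfors_david_covering_number hF0 hFb Ftb hs hFs hreg delta00.
split; first exact: power_law_equi_homogeneous FN.
split; first exact: power_law_lower_assouad_dim FN.
exact: power_law_assouad_dim FN.
Qed.
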